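(* Let $f=(f_1,\dots,f_m)\colon\mathbb{R}^n\to\mathbb{R}^m$ and $g\colon\mathbb{R}^n\to Y$ be continuously Fréchet differentiable on $\mathbb{R}^n$, where $Y$ is a Banach space, let $\Theta\subset Y$ be a closed convex cone, and let $\mathcal{F}=\{x\in\mathbb{R}^n : g(x)\in-\Theta\}$. Assume that each $f_i$, $i=1,\dots,m$, is convex and that $g$ is $\Theta$-convex, and let $\bar x\in\mathcal{F}$. Then $\bar x$ is a (global) weak efficient solution of the problem of minimizing $f$ over $\mathcal{F}$ with respect to $\mathbb{R}^m_+$ if and only if $\bar x$ satisfies the AKKT condition.
   Context: $\mathbb{R}^m_+$ is the nonnegative orthant of $\mathbb{R}^m$; $m,n\ge 1$; $\mathbb{R}^n$ has the Euclidean norm and usual scalar product (identified with its dual). $Y^*$ is the dual of $Y$, $\langle\cdot,\cdot\rangle$ is the canonical pairing, and $\Theta_+:=\{\mu\in Y^* : \langle\mu,\theta\rangle\ge 0\ \ \forall\theta\in\Theta\}$. $\nabla f_i(x)$ is the gradient of $f_i$, $\nabla g(x)\colon\mathbb{R}^n\to Y$ is the derivative of $g$ at $x$, and $\nabla g(x)^*\colon Y^*\to\mathbb{R}^n$ is its adjoint. The mapping $g$ is $\Theta$-convex if $g(tx+(1-t)y)-tg(x)-(1-t)g(y)\in-\Theta$ for all $x,y\in\mathbb{R}^n$ and $t\in[0,1]$. A point $\bar x\in\mathcal{F}$ is a (global) weak efficient solution if no $x\in\mathcal{F}$ satisfies $f_i(x)<f_i(\bar x)$ for all $i=1,\dots,m$.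 A point $\bar x\in\mathcal{F}$ satisfies the AKKT (approximate Karush--Kuhn--Tucker) condition if there exist $\lambda\in\mathbb{R}^m_+$ with $\sum_{i=1}^m\lambda_i=1$ and sequences $\{x^k\}\subset\mathbb{R}^n$ (not required to be feasible) and $\{\mu^k\}\subset\Theta_+$ such that, as $k\to\infty$: $x^k\to\bar x$; $\nabla g(x^k)^*\mu^k+\sum_{i=1}^m\lambda_i\nabla f_i(\bar x)\to 0$; and $\langle\mu^k,g(x^k)\rangle\to 0$. *)

(* Defs.v *)
From HB Require Import structures.
From mathcomp Require Import all_boot all_order all_algebra.
From mathcomp Require Import all_classical all_reals all_analysis.
Import Order.TTheory GRing.Theory Num.Theory.
Import numFieldNormedType.Exports.

Set Implicit Arguments.
Unset Strict Implicit.
Unset Printing Implicit Defensive.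

Local Open Scope classical_set_scope.
Local Open Scope ring_scope.

(* R^n is 'rV[R]_n, normed by the library with the sup norm. It is equivalent
   to the Euclidean norm, so limits, differentials and continuity of the
   derivative are the Euclidean ones. *)

(* The vector of R^n that represents a linear form l for the usual scalar
   product (see row_of_formE). *)
Definition row_of_form (R : realType) (n : nat) (l : 'rV[R]_n -> R) : 'rV[R]_n :=
  \row_(j < n) l (delta_mx 0 j).

Lemma row_of_formE (R : realType) (n : nat) (l : {linear 'rV[R]_n -> R^o})
    (h : 'rV[R]_n) : l h = \sum_(j < n) row_of_form l 0 j * h 0 j.
Proof.
rewrite {1}(row_sum_delta h) linear_sum; apply: eq_bigr => j _.
by rewrite linearZ mxE mulrC.
Qed.

Definition gradient (R : realType) (n : nat) (f : 'rV[R]_n -> R^o)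
    (x : 'rV[R]_n) : 'rV[R]_n :=
  row_of_form ('d f x).

(* A^* mu = mu \o A, as a vector of R^n. *)
Definition adjoint (R : realType) (n : nat) (Y : normedModType R)
    (A : 'rV[R]_n -> Y) (mu : Y -> R^o) : 'rV[R]_n :=
  row_of_form (mu \o A).

(* The second conjunct is the continuity of x |-> 'd f x in operator norm. *)
Definition continuously_differentiable (R : realType) (V W : normedModType R)
    (f : V -> W) : Prop :=
  (forall x, differentiable f x) /\
  (forall (x : V) (e : R), 0 < e ->
     \forall y \near x, forall h : V, `|'d f y h - 'd f x h| <= e * `|h|).

Definition component (R : realType) (n m : nat) (f : 'rV[R]_n -> 'rV[R]_m)
    (i : 'I_m) : 'rV[R]_n -> R^o :=
  fun x => f x 0 i.

Definition closed_convex_cone (R : realType) (Y : normedModType R)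
    (Theta : set Y) : Prop :=
  [/\ closed Theta,
      convex_set Theta &
      forall (t : R) (y : Y), 0 <= t -> Theta y -> Theta (t *: y)].

(* The topological dual of Y is the set of continuous {linear Y -> R^o}. *)
Definition dual_cone (R : realType) (Y : normedModType R) (Theta : set Y) :
    set {linear Y -> R^o} :=
  [set mu : {linear Y -> R^o} | continuous mu /\
     forall theta, Theta theta -> 0 <= mu theta].

Definition cone_convex (R : realType) (V Y : normedModType R) (Theta : set Y)
    (g : V -> Y) : Prop :=
  forall (x y : V) (t : R), 0 <= t -> t <= 1 ->
    (-%R @` Theta)
      (g (t *: x + (1 - t) *: y) - t *: g x - (1 - t) *: g y).

Definition feasible_set (R : realType) (V Y : normedModType R) (Theta : set Y)
    (g : V -> Y) : set V :=
  [set x | (-%R @` Theta) (g x)].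

Definition weak_efficient (R : realType) (n m : nat) (F : set 'rV[R]_n)
    (f : 'rV[R]_n -> 'rV[R]_m) (xbar : 'rV[R]_n) : Prop :=
  F xbar /\
  ~ exists x, F x /\ forall i : 'I_m, component f i x < component f i xbar.

Definition AKKT (R : realType) (n m : nat) (Y : normedModType R)
    (Theta : set Y) (f : 'rV[R]_n -> 'rV[R]_m) (g : 'rV[R]_n -> Y)
    (xbar : 'rV[R]_n) : Prop :=
  feasible_set Theta g xbar /\
  exists (lambda : 'rV[R]_m) (x_ : nat -> 'rV[R]_n)
      (mu_ : nat -> {linear Y -> R^o}),
    [/\ forall i, 0 <= lambda 0 i,
        \sum_(i < m) lambda 0 i = 1 &
        forall k, dual_cone Theta (mu_ k)] /\
    [/\ x_ k @[k --> \oo] --> xbar,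
        adjoint ('d g (x_ k)) (mu_ k)
          + \sum_(i < m) lambda 0 i *: gradient (component f i) xbar
          @[k --> \oo] --> (0 : 'rV[R]_n) &
        mu_ k (g (x_ k)) @[k --> \oo] --> (0 : R^o)].

(* Main.v *)
(** If xbar is weakly efficient, then no feasible direction decreases all the
    linearized objectives, and separation from the sublinear functional max_i
    gives multipliers lambda such that c := sum_i lambda_i grad f_i(xbar)
    satisfies <c, x - xbar> >= 0 on the feasible set. Let D be the distance to
    - Theta, a sublinear function on Y. On a small ball around xbar one
    minimizes <c, x - xbar> + |x - xbar|^2 + k D(g x); by compactness of the
    sphere, for k large a minimizer x lies inside the ball. Its first-order
    condition and the Hahn-Banach theorem give mu <= k D with
    mu (g x) = k D(g x) and (dg x)^* mu + c = - 2 (x - xbar); both sides of the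
    last identity and mu (g x) <= - <c, x - xbar> vanish in the limit.
    Conversely, mu_k \o g is convex, so its gradient inequality at x_k and those
    of the f_i at xbar contradict a feasible x that improves every objective. *)

Require Import Defs.
From HB Require Import structures.
From mathcomp Require Import all_boot all_order all_algebra.
From mathcomp Require Import all_classical all_reals all_analysis.
From mathcomp Require Import ring lra.
Import Order.TTheory GRing.Theory Num.Theory.
Import numFieldNormedType.Exports.
Set Implicit Arguments.
Unset Strict Implicit.
Unset Printing Implicit Defensive.
Local Open Scope classical_set_scope.
Local Open Scope ring_scope.

(** * Sublinear functionals and the theorems of Hahn-Banach and Mazur-Orlicz *)

Section HahnBanach.
Variables (R : realType) (V : lmodType R).
Implicit Types (p q : V -> R) (K : set (V * R)).

Definition sublinear p :=
  (forall x y, p (x + y) <= p x + p y) /\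
  (forall (t : R) x, 0 <= t -> p (t *: x) = t * p x).

(** Each [w] in [K] encodes a constraint [w.2 <= l w.1] on a linear [l <= p]; the last clause is its
    compatibility with [p]. *)
Definition cone_below K p :=
  [/\ K (0, 0),
      forall w z, K w -> K z -> K (w.1 + z.1, w.2 + z.2),
      forall (t : R) w, 0 <= t -> K w -> K (t *: w.1, t * w.2) &
      forall w, K w -> w.2 <= p w.1].

Lemma sublinear0 p : sublinear p -> p 0 = 0.
Proof. by case=> _ pZ; rewrite -(scale0r 0) pZ ?mul0r. Qed.

Lemma sublinear_ge_opp p x : sublinear p -> - p (- x) <= p x.
Proof.
move=> sp; have [pD _] := sp; rewrite lerNl -subr_ge0 opprK.
by rewrite (le_trans _ (pD _ _))// addNr sublinear0.
Qed.

(* The largest sublinear functional below p among those with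
   q (- w) <= - r for every (w, r) in K. *)
Definition sublinear_reduction p K u := inf [set p (u + w.1) - w.2 | w in K].

Section Reduction.
Variables (p : V -> R) (K : set (V * R)).
Hypotheses (sp : sublinear p) (Kp : cone_below K p).
Local Notation q := (sublinear_reduction p K).

Lemma sublinear_reduction_le u w : K w -> q u <= p (u + w.1) - w.2.
Proof.
move=> Kw; apply: ge_inf; last by exists w.
(* The infimum is finite because [z.2 <= p z.1 <= p (u + z.1) + p (- u)]. *)
exists (- p (- u)) => _ [z Kz <-].
have [_ _ _ /(_ _ Kz) zp] := Kp; have [/(_ (u + z.1) (- u)) + _] := sp.
by rewrite addrAC subrr add0r; lra.
Qed.

Lemma sublinear_reduction_ge u a :
  (forall w, K w -> a <= p (u + w.1) - w.2) -> a <= q u.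
Proof.
move=> aK; apply: lb_le_inf; last by move=> _ [w Kw <-]; exact: aK.
by have [K0 _ _ _] := Kp; exists (p (u + 0) - 0), (0, 0).
Qed.

Lemma sublinear_reduction_lep u : q u <= p u.
Proof.
have [K0 _ _ _] := Kp.
by rewrite (le_trans (sublinear_reduction_le u K0))//= addr0 subr0.
Qed.

Lemma sublinear_reduction_opp w : K w -> q (- w.1) <= - w.2.
Proof.
move=> Kw; rewrite (le_trans (sublinear_reduction_le _ Kw))//.
by rewrite addNr sublinear0// add0r.
Qed.

(** Adding two elements of [K] gives subadditivity and rescaling one gives homogeneity; the
    inequality [qZ] taken at [t^-1] is the reverse one. *)
Lemma sublinear_reduction_sublinear : sublinear q.
Proof.
have [pD pZ] := sp; have [K0 KD KZ Kle] := Kp.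
have qZ (t : R) x : 0 < t -> t * q x <= q (t *: x).
  move=> t0; have tN0 : t != 0 by rewrite gt_eqF.
  apply: sublinear_reduction_ge => w Kw.
  have ti0 : 0 <= t^-1 by rewrite invr_ge0 ltW.
  have := sublinear_reduction_le x (KZ _ _ ti0 Kw) => /=.
  rewrite -(ler_pM2l t0) => /le_trans; apply.
  rewrite mulrBr mulrA divff// mul1r -(pZ _ _ (ltW t0)) scalerDr scalerA.
  by rewrite divff// scale1r.
split=> [x y|t x].
  rewrite -lerBlDr; apply: sublinear_reduction_ge => w Kw.
  rewrite lerBlDr -lerBlDl; apply: sublinear_reduction_ge => z Kz.
  have := sublinear_reduction_le (x + y) (KD _ _ Kw Kz) => /=.
  have := pD (x + w.1) (y + z.1); rewrite addrACA; lra.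
rewrite le_eqVlt => /predU1P[<-|t0].
  rewrite scale0r mul0r; apply/le_anti/andP; split.
    by rewrite -[leRHS](sublinear0 sp) sublinear_reduction_lep.
  by apply: sublinear_reduction_ge => w Kw; rewrite add0r subr_ge0 Kle.
apply/le_anti/andP; split; last exact: qZ.
have ti0 : 0 < t^-1 by rewrite invr_gt0.
have := qZ _ (t *: x) ti0.
by rewrite scalerA mulVf ?gt_eqF// scale1r ler_pdivrMl.
Qed.

End Reduction.

(** The pointwise infimum is bounded below by [- p (- x)]. For subadditivity, two members chosen for
    [x] and [y] are comparable, and the smaller one serves for [x + y]. *)
Lemma sublinear_chain_inf p (A : set (V -> R)) : A !=set0 ->
  (forall q, A q -> sublinear q /\ forall x, q x <= p x) ->
  (forall q r, A q -> A r ->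
     (forall x, q x <= r x) \/ (forall x, r x <= q x)) ->
  exists q, sublinear q /\ forall r, A r -> forall x, q x <= r x.
Proof.
move=> [r0 Ar0] Ap Atot; pose q x := inf [set r x | r in A].
have q_le r x : A r -> q x <= r x.
  move=> Ar; apply: ge_inf; last by exists r.
  exists (- p (- x)) => _ [s As <-]; have [ss sp] := Ap _ As.
  by rewrite (le_trans _ (sublinear_ge_opp x ss))// lerN2.
have q_ge x a : (forall r, A r -> a <= r x) -> a <= q x.
  move=> aA; apply: lb_le_inf; first by exists (r0 x), r0.
  by move=> _ [r Ar <-]; exact: aA.
exists q; split=> //; last by move=> r Ar x; exact: q_le.
split=> [x y|t x t0].
  rewrite -lerBlDr; apply: (q_ge) => r Ar.
  rewrite lerBlDr -lerBlDl; apply: (q_ge) => s As; rewrite lerBlDl.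
  have [[rD _] _] := Ap _ Ar; have [[sD _] _] := Ap _ As.
  have [rs|sr] := Atot _ _ Ar As.
    by rewrite (le_trans (q_le _ _ Ar))// (le_trans (rD _ _))// lerD2l.
  by rewrite (le_trans (q_le _ _ As))// (le_trans (sD _ _))// lerD2r.
apply/le_anti/andP; split; last first.
  apply: (q_ge) => r Ar; have [[_ rZ] _] := Ap _ Ar.
  by rewrite rZ// ler_wpM2l// q_le.
have /predU1P[<-|{}t0] : (0 == t) || (0 < t) by rewrite -le_eqVlt.
  rewrite scale0r mul0r -[leRHS](sublinear0 (Ap _ Ar0).1); exact: q_le.
rewrite -ler_pdivrMl//; apply: (q_ge) => r Ar; have [[_ rZ] _] := Ap _ Ar.
by rewrite ler_pdivrMl// -(rZ _ _ (ltW t0)) q_le.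
Qed.

(** The hypothesis makes [q] odd; oddness extends homogeneity to negative scalars and turns
    subadditivity at opposite vectors into superadditivity. *)
Lemma linear_of_sublinear q : sublinear q -> (forall x, q (- x) <= - q x) ->
  exists l : {linear V -> R^o}, forall x, l x = q x.
Proof.
move=> sq qN'; have [qD qZ] := sq.
have qN x : q (- x) = - q x.
  by apply/le_anti/andP; split; rewrite // lerNl sublinear_ge_opp.
have qlin : linear_for *:%R (q : V -> R^o).
  have qZ' t x : q (t *: x) = t * q x.
    have [t0|t0] := leP 0 t; first exact: qZ.
    by rewrite -[t in LHS]opprK scaleNr qN qZ ?oppr_ge0 1?ltW// mulNr opprK.
  move=> t x y; rewrite -[t *: q x]/(t * q x) -qZ'.
  apply/le_anti/andP; split; first exact: qD.
  rewrite -[q _ + _]opprK opprD -!qN lerNl -qN opprD; exact: qD.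
pose qL := GRing.isLinear.Build R V R^o *:%R q qlin.
by exists (HB.pack_for {linear V -> R^o} q qL).
Qed.

(* A minimal sublinear functional is linear: reducing it along a ray
   [{(t *: u, t * q u)}] cannot change it. *)
Lemma hahn_banach_sublinear p : sublinear p ->
  exists l : {linear V -> R^o}, forall x, l x <= p x.
Proof.
move=> sp.
pose T := {q : V -> R | sublinear q /\ forall x, q x <= p x}.
(* The order is reversed, so that a maximal element in Zorn's lemma is a minimal functional. *)
pose geT (s t : T) := `[< forall x, sval t x <= sval s x >].
have [| | |[q [sq qp]] qmin] := @ZL_preorder T
    (exist _ p (conj sp (fun x => lexx _))) geT.
- by move=> t; apply/asboolP => x.
- move=> r s t /asboolP rs /asboolP st; apply/asboolP => x.
  by rewrite (le_trans (st _)).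
- move=> A Atot.
  have [[t At]|A0] := pselect (A !=set0); last first.
    exists (exist _ p (conj sp (fun x => lexx _))) => s As.
    by exfalso; apply: A0; exists s.
  have [||| q [sq qA]] := @sublinear_chain_inf p (sval @` A).
  + by exists (sval t), t.
  + by move=> _ [s _ <-]; exact: (svalP s).
  + move=> _ _ [r Ar <-] [s As <-].
    by have [/asboolP|/asboolP] := Atot _ _ Ar As; [right|left].
  have qp x : q x <= p x.
    by apply: le_trans ((svalP t).2 x); apply: qA; exists t.
  exists (exist _ q (conj sq qp)) => s As; apply/asboolP => x /=.
  by apply: qA; exists s.
have [|l lq] := @linear_of_sublinear q sq; last first.
  by exists l => x; rewrite lq.
move=> u; have [_ qZ] := sq.
pose K := [set w : V * R | exists2 t, 0 <= t & w = (t *: u, t * q u)].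
have Kq : cone_below K q.
  split=> [|_ _ [s s0 ->] [t t0 ->]|t _ t0 [s s0 ->]|_ [t t0 ->]] /=.
  - by exists 0; rewrite // scale0r mul0r.
  - by exists (s + t); rewrite ?addr_ge0// scalerDl mulrDl.
  - by exists (t * s); rewrite ?mulr_ge0// scalerA mulrA.
  - by rewrite qZ.
have Ku : K (u, q u) by exists 1; rewrite // scale1r mul1r.
(* It remains to bound [q (- u)] by the reduction at [- u], which follows from the minimality of
   [q]. *)
apply: le_trans (sublinear_reduction_opp sq Kq Ku).
have rp x : sublinear_reduction q K x <= p x.
  by rewrite (le_trans (sublinear_reduction_lep sq Kq _)).
by have /asboolP/(_ (- u)) := qmin (exist _ _
  (conj (sublinear_reduction_sublinear sq Kq) rp))
  (asboolT (sublinear_reduction_lep sq Kq)).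
Qed.

(** Hahn-Banach is applied to the reduction of [p] by [K], whose values at [- w.1] encode the
    constraints. This yields both the multipliers of the objectives and those of the constraint. *)
Lemma mazur_orlicz p K : sublinear p -> cone_below K p ->
  exists l : {linear V -> R^o},
    (forall x, l x <= p x) /\ (forall w, K w -> w.2 <= l w.1).
Proof.
move=> sp Kp.
have [l lq] := hahn_banach_sublinear (sublinear_reduction_sublinear sp Kp).
exists l; split=> [x|w Kw].
  by rewrite (le_trans (lq x))// sublinear_reduction_lep.
by rewrite -lerN2 -linearN (le_trans (lq _))// sublinear_reduction_opp.
Qed.

End HahnBanach.

(** * The distance to the opposite of a closed convex cone *)

Section ConeDistance.
Variables (R : realType) (Y : normedModType R) (Theta : set Y).
Hypotheses (Theta_cone : closed_convex_cone Theta) (Theta_neq0 : Theta !=set0).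

Lemma closed_convex_cone0 : Theta 0.
Proof.
have [_ _ TZ] := Theta_cone; have [y Ty] := Theta_neq0.
by rewrite -(scale0r y); exact: TZ.
Qed.

Lemma closed_convex_coneD y z : Theta y -> Theta z -> Theta (y + z).
Proof.
have [_ Tconv TZ] := Theta_cone => Ty Tz.
have h0 : (0 : R) <= 2^-1 by lra.
have h1 : (2^-1 : R) <= 1 by lra.
(* The sum is twice the midpoint. *)
have /(_ (mem_set Ty) (mem_set Tz)) := Tconv y z (Itv01 h0 h1).
rewrite inE /conv/= => Tyz.
have := TZ 2 _ (ler0n _ _) Tyz.
rewrite scalerDr !scalerA /unstable.onem.
have -> : (2 : R) * 2^-1 = 1 by lra.
have -> : (2 : R) * (1 - 2^-1) = 1 by lra.
by rewrite !scale1r.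
Qed.

(** This is the infimum of [|y + theta|] over [theta] in [Theta], the distance from [y] to
    [- Theta]. As a reduction of the norm it is sublinear at once. *)
Definition cone_dist : Y -> R :=
  sublinear_reduction (fun y : Y => `|y|) [set w | Theta w.1 /\ w.2 = 0].

Lemma sublinear_norm : sublinear (fun y : Y => `|y|).
Proof.
split=> [x y|t x t0]; first exact: ler_normD.
by rewrite normrZ ger0_norm.
Qed.

Lemma cone_below_norm :
  cone_below [set w | Theta w.1 /\ w.2 = 0] (fun y : Y => `|y|).
Proof.
have [_ _ TZ] := Theta_cone.
split=> /= [|w z [Tw ->] [Tz ->]|t w t0 [Tw ->]|w [_ ->]//].
- by split=> //; exact: closed_convex_cone0.
- by rewrite addr0; split=> //; exact: closed_convex_coneD.
- by rewrite mulr0; split=> //; exact: TZ.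
Qed.

Lemma cone_dist_sublinear : sublinear cone_dist.
Proof. exact: sublinear_reduction_sublinear sublinear_norm cone_below_norm. Qed.

Lemma cone_dist_ge0 y : 0 <= cone_dist y.
Proof.
by apply: (sublinear_reduction_ge cone_below_norm) => w [_ ->]; rewrite subr0.
Qed.

Lemma cone_dist_le_norm y : cone_dist y <= `|y|.
Proof. exact: (sublinear_reduction_lep sublinear_norm cone_below_norm). Qed.

Lemma cone_dist_opp theta : Theta theta -> cone_dist (- theta) <= 0.
Proof.
move=> Tt; rewrite -oppr0.
exact: (@sublinear_reduction_opp _ _ _ _ sublinear_norm cone_below_norm
  (theta, 0)).
Qed.

(** As [Theta] is closed, it suffices that it meets every ball around [- y]; a ball of radius [e]
    missing [Theta] would force the distance to be at least [e]. *)
Lemma cone_dist_eq0 y : cone_dist y <= 0 -> Theta (- y).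
Proof.
move=> y0; have [Tcl _ _] := Theta_cone; apply: Tcl => B /nbhs_ballP[e e0 eB].
apply: contrapT => nB; have : e <= cone_dist y.
  apply: (sublinear_reduction_ge cone_below_norm) => -[w _] [/= Tw ->].
  rewrite subr0 leNgt; apply/negP => we; apply: nB; exists w; split=> //.
  apply: eB; rewrite -ball_normE/= -normrN opprB opprK addrC//.
by move=> ey; move: (le_trans ey y0); rewrite leNgt => /negP; apply.
Qed.

(** Subadditivity and the bound by the norm make the distance 1-Lipschitz. *)
Lemma cone_dist_continuous : continuous cone_dist.
Proof.
have [dD _] := cone_dist_sublinear.
have lip y z : cone_dist y - cone_dist z <= `|y - z|.
  rewrite lerBlDr (le_trans _ (lerD (cone_dist_le_norm _) (lexx _)))//.
  by rewrite (le_trans _ (dD _ _))// subrK.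
move=> y; apply/cvgrPdist_le => e e0; near=> z.
apply: (@le_trans _ _ `|y - z|).
  by rewrite ler_norml lip andbT lerNl opprB distrC lip.
by near: z; apply: cvgr_dist_le.
Unshelve. all: by end_near. Qed.

Lemma feasible_setP (V : normedModType R) (g : V -> Y) x :
  feasible_set Theta g x <-> Theta (- g x).
Proof.
by split=> [[y Ty <-]|Tgx]; [rewrite opprK|exists (- g x); rewrite ?opprK].
Qed.

Lemma feasible_set_convex (V : normedModType R) (g : V -> Y) x y (t : R) :
  cone_convex Theta g -> 0 <= t -> t <= 1 ->
  feasible_set Theta g x -> feasible_set Theta g y ->
  feasible_set Theta g (t *: x + (1 - t) *: y).
Proof.
have [_ _ TZ] := Theta_cone.
move=> gconv t0 t1 [a Ta ax] [b Tb bx]; have [c Tc] := gconv x y t t0 t1.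
rewrite -ax -bx !scalerN !opprK => cE; exists (c + t *: a + (1 - t) *: b).
  apply: closed_convex_coneD; last by apply: TZ; rewrite ?subr_ge0.
  by apply: closed_convex_coneD => //; apply: TZ.
by rewrite !opprD cE addrAC !addrK.
Qed.

End ConeDistance.

Lemma differentiable_right_cvg (R : realType) (V W : normedModType R)
    (f : V -> W) (x h : V) : differentiable f x ->
  (fun t : R => t^-1 *: (f (x + t *: h) - f x)) @ 0^'+ --> 'd f x h.
Proof.
move=> fx; apply: cvg_dnbhs_at_right; rewrite -deriveE//.
rewrite [X in X @ _ --> _](_ : _ =
    (fun t : R => t^-1 *: ((f \o shift x) (t *: h) - f x))).
  exact: (@diff_derivable _ _ _ f x h fx).
by apply/funext => t /=; rewrite (addrC x).
Qed.

(** * The usual scalar product on row vectors *)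

Section DotProduct.
Variables (R : realType) (n : nat).
Implicit Types u v w : 'rV[R]_n.

Definition dotr u v : R := \sum_(j < n) u 0 j * v 0 j.

Lemma dotrDl u v w : dotr (u + v) w = dotr u w + dotr v w.
Proof.
by rewrite /dotr -big_split/=; apply: eq_bigr => j _; rewrite mxE mulrDl.
Qed.

Lemma dotrZl (t : R) u v : dotr (t *: u) v = t * dotr u v.
Proof.
by rewrite /dotr mulr_sumr; apply: eq_bigr => j _; rewrite mxE mulrA.
Qed.

Lemma dotrC u v : dotr u v = dotr v u.
Proof. by apply: eq_bigr => j _; rewrite mulrC. Qed.

Lemma dotrDr u v w : dotr u (v + w) = dotr u v + dotr u w.
Proof. by rewrite dotrC dotrDl !(dotrC u). Qed.

Lemma dotrZr (t : R) u v : dotr u (t *: v) = t * dotr u v.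
Proof. by rewrite dotrC dotrZl dotrC. Qed.

Lemma dotr0 u : dotr u 0 = 0.
Proof. by rewrite -(scale0r 0) dotrZr mul0r. Qed.

Lemma dotr_suml I (r : seq I) (P : pred I) (F : I -> 'rV[R]_n) v :
  dotr (\sum_(i <- r | P i) F i) v = \sum_(i <- r | P i) dotr (F i) v.
Proof.
elim/big_rec2: _ => [|i u x _ <-]; first by rewrite dotrC dotr0.
by rewrite dotrDl.
Qed.

Lemma dotr_delta u (j : 'I_n) : dotr u (delta_mx 0 j) = u 0 j.
Proof.
rewrite /dotr (bigD1 j)//= mxE !eqxx mulr1 big1 ?addr0// => i ij.
by rewrite mxE (negbTE ij) andbF mulr0.
Qed.

Lemma dotrr_ge0 u : 0 <= dotr u u.
Proof. by apply: sumr_ge0 => j _; rewrite -expr2 sqr_ge0. Qed.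

Lemma dotrr_gt0 u : u != 0 -> 0 < dotr u u.
Proof.
move=> u0; rewrite lt_def dotrr_ge0 andbT.
apply: contra u0 => /eqP uu; apply/eqP/rowP => j; rewrite mxE; apply/eqP.
have /psumr_eq0P : forall j, true -> 0 <= u 0 j * u 0 j.
  by move=> i _; rewrite -expr2 sqr_ge0.
by move=> /(_ uu j isT)/eqP; rewrite mulf_eq0 orbb.
Qed.

Lemma cvg_dotr T (F : set_system T) {FF : Filter F} (f g : T -> 'rV[R]_n) u v :
  f @ F --> u -> g @ F --> v -> dotr (f t) (g t) @[t --> F] --> dotr u v.
Proof.
move=> fu gv; rewrite /dotr.
apply: (@cvg_big R _ +%R 0 predT add_continuous _ F _
  (fun j t => f t 0 j * g t 0 j) (fun j => u 0 j * v 0 j)) => j _; apply: cvgM.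
  exact: (cvg_comp _ _ fu (@coord_continuous R 1 n 0 j u)).
exact: (cvg_comp _ _ gv (@coord_continuous R 1 n 0 j v)).
Qed.

Lemma dotr_row_of_form (l : {linear 'rV[R]_n -> R^o}) v :
  dotr (row_of_form l) v = l v.
Proof. by rewrite [RHS]row_of_formE. Qed.

End DotProduct.

(** * Multipliers of the objectives, by separation *)

Section Scalarization.
Variables (R : realType) (m n : nat).

(** The default value is an entry of [u], so this is the true maximum even when all entries are
    negative. *)
Definition row_max (u : 'rV[R]_m.+1) : R := \big[Num.max/u 0 0]_i u 0 i.

Lemma row_max_leP (u : 'rV[R]_m.+1) a :
  (row_max u <= a) <-> (forall i, u 0 i <= a).
Proof.
split=> [+ i|ua]; first exact/le_trans/le_bigmax.
by apply: bigmax_le.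
Qed.

Lemma row_max_ltP (u : 'rV[R]_m.+1) a :
  (row_max u < a) <-> (forall i, u 0 i < a).
Proof.
split=> [+ i|ua]; first exact/le_lt_trans/le_bigmax.
by apply: bigmax_lt.
Qed.

Lemma sublinear_row_max : sublinear row_max.
Proof.
have ge (u : 'rV[R]_m.+1) i : u 0 i <= row_max u by move: i; apply/row_max_leP.
split=> [x y|t x].
  by apply/row_max_leP => i; rewrite mxE lerD.
have le (s : R) (u : 'rV[R]_m.+1) : 0 <= s -> row_max (s *: u) <= s * row_max u.
  by move=> s0; apply/row_max_leP => i; rewrite mxE ler_wpM2l.
rewrite le_eqVlt => /predU1P[<-|t0].
  rewrite scale0r mul0r; apply/le_anti/andP; split.
    by apply/row_max_leP => i; rewrite mxE.
  by rewrite (le_trans _ (ge _ 0))// mxE.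
apply/le_anti/andP; split; first exact/le/ltW.
have ti0 : 0 <= t^-1 by rewrite invr_ge0 ltW.
rewrite -ler_pdivlMl//; apply: le_trans (le _ _ ti0).
by rewrite scalerA mulVf ?scale1r// gt_eqF.
Qed.

Variables (f : 'rV[R]_n -> 'rV[R]_m.+1) (F : set 'rV[R]_n) (xbar : 'rV[R]_n).
Hypotheses (f_diff : forall x : 'rV[R]_n, differentiable f x)
  (F_convex : forall x y (t : R), 0 <= t -> t <= 1 -> F x -> F y ->
     F (t *: x + (1 - t) *: y)).

Lemma component_differentiable i x : differentiable (component f i) x.
Proof.
exact: (@differentiable_comp _ _ _ _ f (fun M : 'rV[R]_m.+1 => M 0 i : R^o) x
  (f_diff x) (@differentiable_coord R 1 m.+1 (f x) 0 i)).
Qed.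

(** One step length is enough: when [xbar] is in [F], convexity of [F] gives all shorter ones. *)
Definition feasible_direction (h : 'rV[R]_n) :=
  exists2 t : R, 0 < t & F (xbar + t *: h).

Lemma feasible_directionD (h k : 'rV[R]_n) :
  feasible_direction h -> feasible_direction k ->
  feasible_direction (h + k).
Proof.
move=> [s s0 Fs] [t t0 Ft]; have st0 : 0 < s + t by rewrite addr_gt0.
(* With this step length the new point is a convex combination of the two given ones, with weights
   [t / (s + t)] and [s / (s + t)]. *)
exists (s * t / (s + t)); first by rewrite divr_gt0 ?mulr_gt0.
have -> : xbar + (s * t / (s + t)) *: (h + k) =
    (t / (s + t)) *: (xbar + s *: h) + (1 - t / (s + t)) *: (xbar + t *: k).
  apply/rowP => j; rewrite !mxE; field; exact: lt0r_neq0.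
apply: F_convex => //; first by rewrite divr_ge0// ltW.
by rewrite ler_pdivrMr// mul1r lerDr ltW.
Qed.

Lemma feasible_directionZ (h : 'rV[R]_n) (t : R) : F xbar -> 0 <= t ->
  feasible_direction h -> feasible_direction (t *: h).
Proof.
move=> Fx; rewrite le_eqVlt => /predU1P[<- _|t0 [s s0 Fs]].
  by exists 1; rewrite // scale0r scaler0 addr0.
exists (s / t); first by rewrite divr_gt0.
by rewrite scalerA divfK// gt_eqF.
Qed.

(** If all these derivatives were negative, a small step along [h] would decrease the finitely many
    components at once and stay in [F] by convexity. *)
Lemma weak_efficient_direction (h : 'rV[R]_n) : weak_efficient F f xbar ->
  feasible_direction h -> exists i, 0 <= 'd (component f i) xbar h.
Proof.
move=> [Fx weff] [s s0 Fs]; apply: contrapT => neg; apply: weff.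
have fi_lt (i : 'I_m.+1) : \forall t \near 0^'+,
    component f i (xbar + t *: h) < component f i xbar.
  have di0 : 'd (component f i) xbar h < 0.
    by rewrite ltNge; apply/negP => di; apply: neg; exists i.
  have fi := differentiable_right_cvg (h := h)
    (component_differentiable i xbar).
  near=> t; have t0 : 0 < t by near: t; exact: nbhs_right_gt.
  rewrite -subr_lt0 -(pmulr_rlt0 (x := t^-1)) ?invr_gt0//.
  by near: t; exact: (cvgr_lt _ fi).
have fall := filter_forall _ fi_lt.
near (0 : R)^'+ => t; exists (xbar + t *: h); split; last first.
  by near: t; exact: fall.
have t0 : 0 < t by near: t; exact: nbhs_right_gt.
have ts : t < s by near: t; exact: nbhs_right_lt.
have -> : xbar + t *: h =
    (t / s) *: (xbar + s *: h) + (1 - t / s) *: xbar.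
  apply/rowP => j; rewrite !mxE; field; exact: lt0r_neq0.
apply: F_convex => //; first by rewrite divr_ge0// ltW.
by rewrite ler_pdivrMr// mul1r ltW.
Unshelve. all: by end_near. Qed.

Lemma weak_efficient_multiplier : weak_efficient F f xbar ->
  exists lambda : 'rV[R]_m.+1, [/\ forall i, 0 <= lambda 0 i,
    \sum_i lambda 0 i = 1 &
    forall x, F x ->
      0 <= \sum_i lambda 0 i * 'd (component f i) xbar (x - xbar)].
Proof.
move=> weff; have [Fx _] := weff.
pose d (h : 'rV[R]_n) : 'rV[R]_m.+1 := \row_i 'd (component f i) xbar h.
have dD (h k : 'rV[R]_n) : d (h + k) = d h + d k.
  by apply/rowP => i; rewrite !mxE linearD.
have dZ (t : R) (h : 'rV[R]_n) : d (t *: h) = t *: d h.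
  by apply/rowP => i; rewrite !mxE linearZ.
have d0 : d 0 = 0 by apply/rowP => i; rewrite !mxE linear0.
(* The constraints ask [l] to be nonnegative on the derivatives along feasible directions; weak
   efficiency is exactly their compatibility with [row_max]. *)
pose K := [set w : 'rV[R]_m.+1 * R |
  exists2 h, feasible_direction h & w = (d h, 0)].
have Kmax : cone_below K row_max.
  split=> [|_ _ [h Fh ->] [k Fk ->]|t _ t0 [h Fh ->]|_ [h Fh ->]] /=.
  - by exists 0; [exists 1; rewrite // scaler0 addr0|rewrite d0].
  - exists (h + k); first exact: feasible_directionD.
    by rewrite dD addr0.
  - exists (t *: h); first exact: feasible_directionZ.
    by rewrite dZ mulr0.
  - have [i i0] := weak_efficient_direction weff Fh.
    rewrite leNgt; apply/negP => /row_max_ltP/(_ i).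
    by rewrite mxE ltNge i0.
have [l [lmax Kl]] := mazur_orlicz sublinear_row_max Kmax.
have lE u : l u = \sum_i row_of_form l 0 i * u 0 i := row_of_formE l u.
exists (row_of_form l); split=> [i||x Fxx].
(* Here [l <= row_max] is tested at the opposite of a basis vector. *)
- rewrite mxE -oppr_le0 -linearN (le_trans (lmax _))//.
  by apply/row_max_leP => j; rewrite !mxE oppr_le0 ler0n.
- have l1 : l (const_mx 1) = \sum_i row_of_form l 0 i.
    by rewrite lE; apply: eq_bigr => i _; rewrite [const_mx _ _ _]mxE mulr1.
  (* Testing at the constant vectors [1] and [-1] gives the two inequalities. *)
  rewrite -l1; apply/le_anti/andP; split.
    by rewrite (le_trans (lmax _))//; apply/row_max_leP => j; rewrite mxE.
  rewrite -lerN2 -linearN (le_trans (lmax _))//.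
  by apply/row_max_leP => j; rewrite !mxE.
- have -> : \sum_i row_of_form l 0 i * 'd (component f i) xbar (x - xbar) =
      l (d (x - xbar)).
    by rewrite lE; apply: eq_bigr => i _; congr (_ * _); rewrite [RHS]mxE.
  apply: (Kl (d (x - xbar), 0)); exists (x - xbar) => //.
  by exists 1; rewrite // scale1r addrC subrK.
Qed.

End Scalarization.

(** * Gradient inequalities for convex maps *)

Lemma diff_le_chord (R : realType) (V W : normedModType R) (f : V -> W)
    (phi : W -> R) (x h : V) (b : R) :
  continuous phi -> (forall (t : R) w, 0 <= t -> phi (t *: w) = t * phi w) ->
  differentiable f x ->
  (forall t, 0 < t -> t <= 1 -> phi (f (x + t *: h) - f x) <= t * b) ->
  phi ('d f x h) <= b.
Proof.
move=> cphi phiZ /(differentiable_right_cvg (h := h)) fx fb.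
(* By homogeneity, [phi] of the right difference quotient is [t^-1 * phi (f (x + t *: h) - f x)], at
   most [b]; continuity of [phi] passes this to the limit. *)
apply: (cvgr_to_le (cvg_comp _ _ fx (cphi _))).
near=> t => /=; have t0 : 0 < t by near: t; exact: nbhs_right_gt.
have ti0 : 0 <= t^-1 by rewrite invr_ge0 ltW.
rewrite phiZ// ler_pdivrMl// fb//.
by near: t; exact: nbhs_right_le.
Unshelve. all: by end_near. Qed.

Lemma convex_function_gradient (R : realType) (V : normedModType R)
    (f : V -> R^o) (x y : V) : convex_function setT f -> differentiable f x ->
  'd f x (y - x) <= f y - f x.
Proof.
move=> fconv fx.
apply: (@diff_le_chord _ _ R^o f (fun z => z)) => // [z|t t0 t1].
  exact: cvg_id.
have : f (t *: y + (1 - t) *: x) <= t * f y + (1 - t) * f x.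
  exact: (fconv (Itv01 (ltW t0) t1) y x (in_setT y) (in_setT x)).
have -> : t *: y + (1 - t) *: x = x + t *: (y - x).
  by rewrite scalerBl scale1r scalerBr addrCA.
by lra.
Qed.

(** Since [mu] is nonnegative on [Theta], pairing it with the convexity defect of [g] bounds
    [mu \o g] by its chords. *)
Lemma cone_convex_gradient (R : realType) (V Y : normedModType R)
    (Theta : set Y) (g : V -> Y) (mu : {linear Y -> R^o}) (x y : V) :
  cone_convex Theta g -> dual_cone Theta mu -> differentiable g x ->
  mu ('d g x (y - x)) <= mu (g y) - mu (g x).
Proof.
move=> gconv [cmu mu0] gx.
apply: (@diff_le_chord _ _ _ g mu) => // [t w _|t t0 t1]; first exact: linearZ.
have [a /mu0 + aE] := gconv y x t (ltW t0) t1.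
have -> : x + t *: (y - x) = t *: y + (1 - t) *: x.
  by rewrite scalerBl scale1r scalerBr addrCA.
have /(congr1 mu) := aE; rewrite linearN !linearB !linearZ/=.
rewrite /GRing.scale/=.
by lra.
Qed.

(** * From AKKT to weak efficiency *)

Section Sufficiency.
Variables (R : realType) (m n : nat) (Y : normedModType R).
Variables (f : 'rV[R]_n -> 'rV[R]_m.+1) (g : 'rV[R]_n -> Y) (Theta : set Y).
Variable xbar : 'rV[R]_n.
Hypotheses (f_diff : forall x : 'rV[R]_n, differentiable f x)
  (g_diff : forall x : 'rV[R]_n, differentiable g x)
  (f_convex : forall i, convex_function setT (component f i))
  (g_convex : cone_convex Theta g).

Lemma AKKT_weak_efficient :
  AKKT Theta f g xbar -> weak_efficient (feasible_set Theta g) f xbar.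
Proof.
move=> [Fxbar [lambda [x_ [mu_ [[l0 l1 mu0] [xcvg adjcvg mugcvg]]]]]].
split=> // -[x [Fx fx]].
set c := \sum_i _ in adjcvg.
have dotc h : dotr c h = \sum_i lambda 0 i * 'd (component f i) xbar h.
  rewrite dotr_suml; apply: eq_bigr => i _.
  by rewrite dotrZl dotr_row_of_form.
(* Otherwise the gradient inequalities force each [lambda 0 i * (component f i xbar - component f i
   x)] to be zero, so [lambda] vanishes, against its sum being [1]. *)
have : dotr c (x - xbar) < 0.
  rewrite dotc ltNge; apply/negP => sum_ge0.
  have le0 i : lambda 0 i * 'd (component f i) xbar (x - xbar) <=
      lambda 0 i * (component f i x - component f i xbar).
    rewrite ler_wpM2l// convex_function_gradient//.
    exact: component_differentiable.
  have /psumr_eq0P s0 (i : 'I_m.+1) : true ->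
      0 <= lambda 0 i * (component f i xbar - component f i x).
    by move=> _; rewrite mulr_ge0// subr_ge0 ltW.
  have /s0 lf0 :
      \sum_i lambda 0 i * (component f i xbar - component f i x) = 0.
    apply/le_anti/andP; split; last first.
      by apply: sumr_ge0 => i _; rewrite mulr_ge0// subr_ge0 ltW.
    rewrite -oppr_ge0 -sumrN (le_trans sum_ge0)// ler_sum// => i _.
    by rewrite -mulrN opprB.
  suff : \sum_i lambda 0 i = 0 by rewrite l1 => /eqP; rewrite oner_eq0.
  apply: big1 => i _; have /eqP := lf0 i isT.
  by rewrite mulf_eq0 subr_eq0 (gt_eqF (fx i)) orbF => /eqP.
apply/negP; rewrite -leNgt.
have xx : x - x_ k @[k --> \oo] --> x - xbar.
  by apply: cvgB => //; exact: cvg_cst.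
(* The gradient inequality of [mu_ k \o g] at [x_ k], with [mu_ k (g x) <= 0], compares [lhs] with
   [rhs]; in the limit it reads [0 <= dotr c (x - xbar)]. *)
have lhs := cvg_dotr (FF := eventually_filter) adjcvg xx.
have rhs : - mu_ k (g (x_ k)) + dotr c (x - x_ k) @[k --> \oo] -->
    - 0 + dotr c (x - xbar).
  by apply: cvgD; [exact: cvgN|apply: cvg_dotr => //; exact: cvg_cst].
have := ler_cvg_to lhs rhs; rewrite oppr0 add0r dotrC dotr0; apply.
near=> k; rewrite dotrDl lerD2r.
rewrite (dotr_row_of_form (mu_ k \o 'd g (x_ k)))/=.
have := cone_convex_gradient x g_convex (mu0 k) (g_diff (x_ k)).
have [a Ta <-] := Fx; have := (mu0 k).2 a Ta; rewrite linearN; lra.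
Unshelve. all: by end_near. Qed.

End Sufficiency.

(** * Exterior penalization and multipliers of the constraint *)

Section Penalty.
Variables (R : realType) (n : nat) (Y : normedModType R).
Variables (g : 'rV[R]_n -> Y) (Theta : set Y) (xbar c : 'rV[R]_n).
Hypotheses (g_diff : forall x : 'rV[R]_n, differentiable g x)
  (Theta_cone : closed_convex_cone Theta)
  (xbar_feasible : feasible_set Theta g xbar)
  (c_ge0 : forall x, feasible_set Theta g x -> 0 <= dotr c (x - xbar)).

Let Theta_neq0 : Theta !=set0.
Proof. by exists (- g xbar); exact/(feasible_setP Theta g). Qed.

Local Notation D := (cone_dist Theta).
Let D_sublinear : sublinear D := cone_dist_sublinear Theta_cone Theta_neq0.

(** It vanishes at [xbar], and the quadratic term makes it positive at every other feasible
    point. *)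
Definition penalty (k : R) x :=
  dotr c (x - xbar) + dotr (x - xbar) (x - xbar) + k * D (g x).

Let Dg_continuous : continuous (D \o g).
Proof.
move=> x; apply: continuous_comp; first exact/differentiable_continuous.
exact: cone_dist_continuous.
Qed.

Let sub_xbar_continuous : continuous (fun z : 'rV[R]_n => z - xbar).
Proof.
by move=> z; apply: continuousB; [move=> A|exact: cst_continuous].
Qed.

Lemma penalty_continuous k : continuous (penalty k).
Proof.
have cx := sub_xbar_continuous.
move=> x; rewrite /continuous_at/penalty.
apply: (cvgD (FF := nbhs_filter x)); last first.
  by apply: cvgM; [exact: cvg_cst|exact: Dg_continuous].
apply: (cvgD (FF := nbhs_filter x)).
  by apply: (cvg_dotr (FF := nbhs_filter x)); [exact: cvg_cst|exact: cx].
by apply: (cvg_dotr (FF := nbhs_filter x)); exact: cx.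
Qed.

Lemma penalty_ge k l x : k <= l -> penalty k x <= penalty l x.
Proof. by move=> kl; rewrite lerD2l ler_wpM2r// cone_dist_ge0. Qed.

Lemma penalty_gt0 x : x != xbar -> exists k : nat, 0 < penalty k%:R x.
Proof.
move=> xx; have q0 : 0 < dotr (x - xbar) (x - xbar).
  by rewrite dotrr_gt0// subr_eq0.
have [Dx|Dx] := leP (D (g x)) 0.
  exists 0%N; rewrite /penalty mul0r addr0 ltr_wpDl// c_ge0//.
  apply/(feasible_setP Theta g); exact: cone_dist_eq0.
(* At an infeasible point, any [k > a] lets the distance term outweigh the linear one. *)
pose a := `|dotr c (x - xbar)| / D (g x).
have a0 : 0 <= a by rewrite divr_ge0// ltW.
exists (Num.bound a); have := archi_boundP a0.
rewrite /a ltr_pdivrMr// /penalty.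
have := ler_norm (- dotr c (x - xbar)); rewrite normrN; lra.
Qed.

(** A minimizer over the closed ball has value at most that at [xbar], hence at most [0]. For large
    [k] the penalty is positive on the sphere, so the minimizer is interior. *)
Lemma penalty_minimizer (e : R) : 0 < e ->
  exists (k : R) (x : 'rV[R]_n), [/\ 0 <= k, `|x - xbar| < e,
    penalty k x <= 0 & \forall y \near x, penalty k x <= penalty k y].
Proof.
move=> e0.
have cdist : continuous (fun x : 'rV[R]_n => `|x - xbar|).
  move=> x; apply: continuous_comp; first exact: sub_xbar_continuous.
  exact: norm_continuous.
have dist_closed (A : set R) : closed A ->
    closed [set x : 'rV[R]_n | A `|x - xbar|].
  move=> Acl.
  by apply: (preimage_closed (f := fun x : 'rV[R]_n => `|x - xbar|)).
have bounded_compact (A : set 'rV[R]_n) : closed A ->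
    A `<=` [set x | `|x - xbar| <= e] -> compact A.
  move=> Acl Ae; apply: bounded_closed_compact => //.
  exists (e + `|xbar|); split; first exact: num_real.
  move=> M eM x /Ae/= xe; rewrite -(subrK xbar x) (le_trans (ler_normD _ _))//.
  by rewrite (le_trans _ (ltW eM))// lerD2r.
pose S := [set x : 'rV[R]_n | `|x - xbar| = e].
have Sc : compact S.
  apply: bounded_compact; last by move=> x; rewrite /S/= => ->.
  exact: (dist_closed _ (@closed_eq R e)).
(* Compactness gives one [k] for the whole sphere: positivity at a point persists nearby by
   continuity and for larger [k] by monotonicity. *)
have /compact_near_coveringP/(_ nat \oo
    (fun k x => 0 < penalty k%:R x) _)[] := Sc.
  move=> x Sx; have xx : x != xbar.
    by apply/eqP => xx; move: e0; rewrite -Sx xx subrr normr0 ltxx.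
  have [k0 k0x] := penalty_gt0 xx.
  exists ([set y | 0 < penalty k0%:R y], [set k | (k0 <= k)%N]).
    split; last exact: nbhs_infty_ge.
    exact: (cvgr_gt _ (@penalty_continuous k0%:R x)).
  move=> [y k] /= [y0 k0k]; apply: lt_le_trans y0 _.
  by apply: penalty_ge; rewrite ler_nat.
move=> k _ /(_ k (leqnn k)) Sk.
pose B := [set x : 'rV[R]_n | `|x - xbar| <= e].
have Bc : compact B.
  apply: bounded_compact => //.
  exact: (dist_closed _ (@closed_le R e)).
have Bxbar : B xbar by rewrite /B/= subrr normr0 ltW.
have [x] := EVT_min_rV (ex_intro _ _ Bxbar) Bc
  (continuous_subspaceT (@penalty_continuous k%:R)).
rewrite inE => Bx xmin.
have x0 : penalty k%:R x <= 0.
  rewrite (le_trans (xmin _ (mem_set Bxbar)))// /penalty subrr !dotr0 !add0r.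
  rewrite mulr_ge0_le0// -[g xbar]opprK cone_dist_opp//.
  exact/(feasible_setP Theta g).
have xe : `|x - xbar| < e.
  rewrite lt_neqAle Bx andbT; apply/eqP => Sx.
  by have := Sk x Sx; rewrite ltNge x0.
exists k%:R, x; split=> //; near=> y; apply: xmin; rewrite inE /B/= ltW//.
near: y; exact: (cvgr_lt _ (cdist x)).
Unshelve. all: by end_near. Qed.

(** The increase of the penalty along [t *: h] is divided by [t], then [t] tends to [0]. The
    distance is never differentiated: [g (x + t *: h)] is a convex combination of [g x] and
    [g x + z t], so convexity of [D] suffices. *)
Lemma penalty_direction k x h : 0 <= k ->
  (\forall y \near x, penalty k x <= penalty k y) ->
  k * D (g x) <= dotr (c + 2 *: (x - xbar)) h + k * D (g x + 'd g x h).
Proof.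
move=> k0 xmin; have [DD DZ] := D_sublinear.
pose z (t : R) := t^-1 *: (g (x + t *: h) - g x).
have zcvg : z @ 0^'+ --> 'd g x h by exact: differentiable_right_cvg.
pose v := c + 2 *: (x - xbar).
have tcvg : (t : R) @[t --> 0^'+] --> (0 : R).
  by apply: cvg_at_right_filter; exact: cvg_id.
have xcvg : x + t *: h @[t --> 0^'+] --> x.
  rewrite -[X in _ --> X]addr0 -(scale0r h).
  by apply: cvgD; [exact: cvg_cst|exact: cvgZr_tmp].
have lim : dotr v h + t * dotr h h + k * D (g x + z t) @[t --> 0^'+] -->
    dotr v h + 0 * dotr h h + k * D (g x + 'd g x h).
  apply: cvgD.
    apply: cvgD; first exact: cvg_cst.
    by apply: cvgM => //; exact: cvg_cst.
  apply: cvgM; first exact: cvg_cst.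
  have gz : g x + z t @[t --> 0^'+] --> g x + 'd g x h.
    by apply: cvgD => //; exact: cvg_cst.
  by apply: (cvg_comp _ _ gz); exact: cone_dist_continuous.
rewrite -/v -[dotr v h]addr0 -[X in _ + X + _](mul0r (dotr h h)).
apply: (cvgr_to_ge lim); near=> t.
have t0 : 0 < t by near: t; exact: nbhs_right_gt.
have t1 : t <= 1 by near: t; exact: nbhs_right_le.
have : penalty k x <= penalty k (x + t *: h) by near: t; exact: (xcvg _ xmin).
have gE : g (x + t *: h) = (1 - t) *: g x + t *: (g x + z t).
  rewrite scalerDr /z scalerA divff ?gt_eqF// scale1r scalerBl scale1r.
  by rewrite addrA subrK addrC subrK.
have : D (g (x + t *: h)) <= (1 - t) * D (g x) + t * D (g x + z t).
  by rewrite gE (le_trans (DD _ _))// !DZ// ?subr_ge0// ltW.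
move=> /(ler_wpM2l k0).
have -> : penalty k (x + t *: h) =
    penalty k x + t * (dotr v h + t * dotr h h) +
    k * (D (g (x + t *: h)) - D (g x)).
  rewrite /penalty /v (addrAC x); move: (x - xbar) => d.
  rewrite !(dotrDl, dotrDr, dotrZl, dotrZr) (dotrC h d); ring.
move=> gle ple; rewrite -(ler_pM2l t0).
move: gle ple; nra.
Unshelve. all: by end_near. Qed.

(** The multiplier is a linear functional below [k * D] that attains it at [g x] and is prescribed
    on the range of ['d g x]. *)
Lemma penalty_multiplier k x : 0 <= k -> penalty k x <= 0 ->
  (\forall y \near x, penalty k x <= penalty k y) ->
  exists mu : {linear Y -> R^o}, [/\ dual_cone Theta mu,
    adjoint ('d g x) mu + c = - 2 *: (x - xbar) &
    `|mu (g x)| <= - dotr c (x - xbar)].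
Proof.
move=> k0 x0 xmin; have [DD DZ] := D_sublinear.
pose p y := k * D y.
have psub : sublinear p.
  by split=> [y z|t y t0]; rewrite /p ?DZ// 1?mulrCA// -mulrDr ler_wpM2l.
have [pD pZ] := psub.
pose v := c + 2 *: (x - xbar).
have dir h : p (g x) - dotr v h <= p (g x + 'd g x h).
  by rewrite lerBlDl; exact: penalty_direction.
(* This cone combines the constraints [p (g x) <= mu (g x)] and [- dotr v h <= mu ('d g x h)]. *)
pose K := [set w : Y * R | exists2 s : R, 0 <= s &
  exists h, w = (s *: g x + 'd g x h, s * p (g x) - dotr v h)].
have Kp : cone_below K p.
  split.
  - exists 0; rewrite //; exists 0.
    by rewrite linear0 dotr0 scale0r mul0r addr0 subr0.
  - move=> _ _ [s s0 [h ->]] [t t0 [l ->]] /=.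
    exists (s + t); rewrite ?addr_ge0//; exists (h + l).
    rewrite linearD dotrDr scalerDl; congr (_, _); first by rewrite addrACA.
    by ring.
  - move=> t _ t0 [s s0 [h ->]] /=.
    exists (t * s); rewrite ?mulr_ge0//; exists (t *: h).
    by rewrite linearZ dotrZr scalerDr scalerA mulrBr mulrA.
  (* For [s = 0] subadditivity of [p] cancels [p (g x)] in [dir]; for [s > 0], [dir] is used at
     [s^-1 *: h] and rescaled. *)
  - move=> _ [s + [h ->]] /=; rewrite le_eqVlt => /predU1P[<-|s0].
      rewrite scale0r mul0r !add0r; have := dir h; have := pD (g x) ('d g x h).
      by lra.
    have sN0 : s != 0 by rewrite gt_eqF.
    have := dir (s^-1 *: h); rewrite -(ler_pM2l s0) linearZ/= dotrZr mulrBr.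
    rewrite (mulrA s s^-1) divff// mul1r -!(pZ _ _ (ltW s0)) scalerDr.
    by rewrite scalerA divff// scale1r.
have [mu [mup Kmu]] := mazur_orlicz psub Kp.
have muE h : mu ('d g x h) = - dotr v h.
  have mule l : - dotr v l <= mu ('d g x l).
    apply: (Kmu ('d g x l, - dotr v l)); exists 0 => //; exists l.
    by rewrite scale0r mul0r !add0r.
  apply/le_anti/andP; split; last exact: mule.
  (* Both sides are linear in the direction, so the inequality at [- h] gives equality. *)
  have := mule (- h); rewrite !linearN -scaleN1r dotrZr/=; lra.
have muge : p (g x) <= mu (g x).
  apply: (Kmu (g x, p (g x))); exists 1 => //; exists 0.
  by rewrite linear0 dotr0 scale1r mul1r addr0 subr0.
have munorm y : `|mu y| <= k * `|y|.
  have le z : mu z <= k * `|z|.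
    by rewrite (le_trans (mup z))// ler_wpM2l// cone_dist_le_norm.
  by rewrite ler_norml le andbT lerNl -linearN -normrN le.
exists mu; split.
- split.
    (* The constant [k + 1] can be divided by even when [k = 0]. *)
    have k1 : 0 < k + 1 by rewrite ltr_wpDl.
    move=> y; apply/cvgrPdist_le => e e0; near=> z.
    rewrite -linearB (le_trans (munorm _))//.
    apply: (@le_trans _ _ ((k + 1) * `|y - z|)).
      by rewrite ler_wpM2r// lerDl.
    rewrite -ler_pdivlMl//; near: z; apply: cvgr_dist_le; first exact: cvg_id.
    by rewrite mulr_gt0 ?invr_gt0.
  move=> theta Ttheta; rewrite -oppr_le0 -linearN (le_trans (mup _))//.
  by rewrite mulr_ge0_le0// cone_dist_opp.
- apply/rowP => j; rewrite mxE [adjoint _ _ _ _]mxE/= muE dotr_delta !mxE.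
  by ring.
(* Here [0 <= p (g x) <= mu (g x) <= p (g x)], and [penalty k x <= 0] bounds [p (g x)] by
   [- dotr c (x - xbar)]. *)
- rewrite ger0_norm; last first.
    by rewrite (le_trans _ muge)// mulr_ge0// cone_dist_ge0.
  have q0 := dotrr_ge0 (x - xbar); have := mup (g x).
  by move: x0 q0; rewrite /penalty /p; lra.
Unshelve. all: by end_near. Qed.

(** Minimizers are taken in balls of radius [1 / (k + 1)]. No bound on [mu_] is required: the two
    residuals are controlled by [x_ k - xbar] alone. *)
Lemma sequential_multiplier : exists (x_ : nat -> 'rV[R]_n)
    (mu_ : nat -> {linear Y -> R^o}),
  [/\ forall k, dual_cone Theta (mu_ k),
    x_ k @[k --> \oo] --> xbar,
    adjoint ('d g (x_ k)) (mu_ k) + c @[k --> \oo] --> (0 : 'rV[R]_n) &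
    mu_ k (g (x_ k)) @[k --> \oo] --> (0 : R^o)].
Proof.
have /choice[xmu xmuP] (k : nat) : exists xmu : 'rV[R]_n * {linear Y -> R^o},
    [/\ `|xmu.1 - xbar| < k.+1%:R^-1, dual_cone Theta xmu.2,
     adjoint ('d g (xmu.1)) xmu.2 + c = - 2 *: (xmu.1 - xbar) &
     `|xmu.2 (g xmu.1)| <= - dotr c (xmu.1 - xbar)].
  have e0 : (0 : R) < k.+1%:R^-1 by rewrite invr_gt0.
  have [l [x [l0 xe x0 xmin]]] := penalty_minimizer e0.
  by have [mu [mu1 mu2 mu3]] := penalty_multiplier l0 x0 xmin; exists (x, mu).
pose x_ k := (xmu k).1; pose mu_ k := (xmu k).2.
have xcvg : x_ k - xbar @[k --> \oo] --> (0 : 'rV[R]_n).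
  apply/cvgr0Pnorm_lt => e e0; near=> k.
  have [xk _ _ _] := xmuP k; apply: lt_trans xk _.
  by near: k; exact: near_infty_natSinv_lt (PosNum e0).
exists x_, mu_; split.
- by move=> k; have [] := xmuP k.
- exact/subr_cvg0.
- rewrite (_ : (fun k => _) = (fun k => - 2 *: (x_ k - xbar))); last first.
    by apply/funext => k; have [] := xmuP k.
  rewrite -[X in _ --> X](scaler0 _ (- 2 : R)); exact: cvgZl_tmp.
- apply: norm_cvg0.
  have dcvg : - dotr c (x_ k - xbar) @[k --> \oo] --> (0 : R).
    have := cvgN (cvg_dotr (FF := eventually_filter) (cvg_cst c) xcvg).
    by rewrite dotr0 oppr0; apply.
  apply: (squeeze_cvgr (f := cst 0) _ _ dcvg); last exact: cvg_cst.
  by near=> k; rewrite normr_ge0/=; have [] := xmuP k.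
Unshelve. all: by end_near. Qed.

End Penalty.

(** * From weak efficiency to AKKT, and the equivalence *)

Lemma weak_efficient_AKKT (R : realType) (m n : nat) (Y : normedModType R)
    (f : 'rV[R]_n -> 'rV[R]_m.+1) (g : 'rV[R]_n -> Y) (Theta : set Y)
    (xbar : 'rV[R]_n) :
  (forall x : 'rV[R]_n, differentiable f x) ->
  (forall x : 'rV[R]_n, differentiable g x) ->
  closed_convex_cone Theta -> cone_convex Theta g ->
  weak_efficient (feasible_set Theta g) f xbar -> AKKT Theta f g xbar.
Proof.
move=> f_diff g_diff Theta_cone g_convex weff; have [Fxbar _] := weff.
have F_convex (x y : 'rV[R]_n) t :=
  feasible_set_convex (x := x) (y := y) (t := t) Theta_cone g_convex.
have [lambda [l0 l1 lF]] := weak_efficient_multiplier f_diff F_convex weff.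
pose c := \sum_i lambda 0 i *: gradient (component f i) xbar.
have [|x_ [mu_ [mu1 mu2 mu3 mu4]]] :=
    @sequential_multiplier _ _ _ _ _ _ c g_diff Theta_cone Fxbar.
  move=> x /lF; congr (0 <= _); rewrite dotr_suml; apply: eq_bigr => i _.
  by rewrite dotrZl dotr_row_of_form.
by split=> //; exists lambda, x_, mu_.
Qed.

Theorem theorem3p5 (R : realType) (m n : nat) (Y : completeNormedModType R)
    (f : 'rV[R]_n -> 'rV[R]_m) (g : 'rV[R]_n -> Y) (Theta : set Y)
    (xbar : 'rV[R]_n) (m_ge1 : (1 <= m)%N) (n_ge1 : (1 <= n)%N)
    (f_C1 : continuously_differentiable f)
    (g_C1 : continuously_differentiable g)
    (Theta_cone : closed_convex_cone Theta)
    (f_convex : forall i : 'I_m, convex_function setT (component f i))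
    (g_convex : cone_convex Theta g)
    (xbar_feasible : feasible_set Theta g xbar) :
  weak_efficient (feasible_set Theta g) f xbar <-> AKKT Theta f g xbar.
Proof.
(* Writing the number of objectives as a successor provides the entry [0] that [row_max] starts
   from. *)
case: m => // m in m_ge1 f f_C1 f_convex *.
have [f_diff _] := f_C1; have [g_diff _] := g_C1.
split; first exact: weak_efficient_AKKT.
exact: AKKT_weak_efficient.
Qed.
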